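(* Let $(\Omega,S)$ be a Frobenius scheme of valency $k$ and rank at least $4(k-1)k^3$. Then $(\Omega,S)$ is determined up to isomorphism by its intersection numbers: every scheme $(\Omega',S')$ algebraically isomorphic to $(\Omega,S)$ is isomorphic to $(\Omega,S)$ (indeed every algebraic isomorphism $\varphi:S\to S'$ is induced by an isomorphism).
   Context: A coherent configuration is a pair $(\Omega,S)$ with $\Omega$ finite and $S$ a partition of $\Omega\times\Omega$ such that the diagonal $1_\Omega$ is a union of elements of $S$, $S$ is closed under transposition, and for $r,s,t\in S$ the number $c_{rs}^t=|\{\beta:(\alpha,\beta)\in r,(\beta,\gamma)\in s\}|$ does not depend on $(\alpha,\gamma)\in t$ (intersection numbers). A scheme is one with $1_\Omega\in S$; rank $|S|$; valency $n_s=|\{\beta:(\alpha,\beta)\in s\}|$. A Frobenius group is a non-regular transitive permutation group $G\le\mathrm{Sym}(\Omega)$ in which only the identity fixes two distinct points; a Frobenius scheme is the scheme of a Frobenius group, i.e. $S$ is the set of orbits of $G$ on $\Omega\times\Omega$; all its basis relations other than $1_\Omega$ have the same valency $k$ (equal to the order of a point stabilizer), called the valency of the scheme. An algebraic isomorphism $\varphi:S\to S'$ is a bijection with $c_{\varphi(r)\varphi(s)}^{\varphi(t)}=c_{rs}^t$ for all $r,s,t$; an isomorphism is a bijection $f:\Omega\to\Omega'$ mapping each element of $S$ onto an element of $S'$; it induces $\varphi$ if $f(s)=\varphi(s)$ for all $s\in S$. *)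

(* Defs.v *)
From mathcomp Require Import all_boot all_fingroup.
Set Implicit Arguments. Unset Strict Implicit. Unset Printing Implicit Defensive.

Section CC.
Variable Omega : finType.
Notation rel := {set Omega * Omega}.

Definition diag : rel := [set x | x.1 == x.2].
Definition transp (r : rel) : rel := [set x | (x.2, x.1) \in r].
Definition nbeta (r s : rel) (a c : Omega) : nat :=
  #|[set b | ((a, b) \in r) && ((b, c) \in s)]|.
Definition valency_at (s : rel) (a : Omega) : nat := #|[set b | (a, b) \in s]|.

Definition coherent (S : {set rel}) : Prop :=
  [/\ partition S [set: Omega * Omega],
      (forall x, x \in diag -> forall s, s \in S -> x \in s -> s \subset diag),
      (forall s, s \in S -> transp s \in S) &
      (forall r s t, r \in S -> s \in S -> t \in S ->
         forall x y, x \in t -> y \in t -> nbeta r s x.1 x.2 = nbeta r s y.1 y.2)].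

Definition scheme (S : {set rel}) : Prop := coherent S /\ diag \in S.

(* intersection number c_{rs}^t (evaluated at some pair of t; well defined for
   coherent configurations, whose classes are nonempty) *)
Definition inum (r s t : rel) : nat :=
  if [pick x in t] is Some x then nbeta r s x.1 x.2 else 0.

(* valency n_s: independent of alpha in a scheme; defined as requiring it for all alpha *)
Definition has_valency (s : rel) (k : nat) : Prop :=
  forall a, valency_at s a = k.

Definition frobenius (G : {group {perm Omega}}) : Prop :=
  [/\ [transitive G, on [set: Omega] | 'P],
      (exists a : Omega, ('C_G[a | 'P])%g != 1%g) &
      (forall g, g \in G -> forall a b : Omega, a != b ->
          g a = a -> g b = b -> g = 1%g)].

Definition orbitals (G : {group {perm Omega}}) : {set rel} :=
  [set [set ((g : {perm Omega}) x.1, (g : {perm Omega}) x.2) | g in G] | x : Omega * Omega].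

End CC.

Definition alg_iso (O O' : finType) (S : {set {set O * O}}) (S' : {set {set O' * O'}})
  (phi : {set O * O} -> {set O' * O'}) : Prop :=
  [/\ {in S &, injective phi}, phi @: S = S' &
      forall r s t, r \in S -> s \in S -> t \in S ->
        inum (phi r) (phi s) (phi t) = inum r s t].

Definition rimage (O O' : finType) (f : O -> O') (s : {set O * O}) : {set O' * O'} :=
  [set (f x.1, f x.2) | x in s].

Definition induces (O O' : finType) (S : {set {set O * O}})
  (f : O -> O') (phi : {set O * O} -> {set O' * O'}) : Prop :=
  bijective f /\ forall s, s \in S -> rimage f s = phi s.

(* Main.v *)
(** Pull the classes of S' back along phi, so that both point sets carry colours
    in S.  In a Frobenius scheme, for generic a, b, c, d the colours of the pairs
    (c, a), (a, d), (c, b), (b, d) leave only one possible colour for (c, d), and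
    this only involves products of two basis relations, hence transfers to S'.
    The failures are counted through fixed points: a nontrivial element of G has
    at most one, so at most k points see two distinct given points in the same
    colour.  Starting from a pair (a0, b0) and a pair of points of the same colour
    in S', every point gets an image with the right colours to these two; the
    images of most points then have the right colours to most others.  A second
    choice of images, relative to most of the first ones, makes this true of
    every point, and any two of the new images are finally compared through two
    auxiliary points. *)
Require Import Defs.
From mathcomp Require Import all_boot all_fingroup.
From mathcomp Require Import zify.
Set Implicit Arguments. Unset Strict Implicit. Unset Printing Implicit Defensive.

(** * Union bounds and arithmetic of the rank bound *)

Lemma exists_notin (T : finType) (B : {set T}) : #|B| < #|T| -> exists z, z \notin B.
Proof.
rewrite -cardsT => ltBT.
have /subsetPn[z _ zB] : ~~ ([set: T] \subset B).
  by apply: contraL ltBT => /subset_leq_card; rewrite -leqNgt.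
by exists z.
Qed.

Lemma card_setU_le (T : finType) (A B : {set T}) : #|A :|: B| <= #|A| + #|B|.
Proof. exact: leq_card_setU. Qed.

Lemma card_cover_le (I T : finType) (A : {set I}) (B : {set T}) (P : I -> pred T) (m K : nat) :
  #|A| <= m ->
  (forall z, z \in B -> exists2 i, i \in A & P i z) ->
  (forall i, i \in A -> #|[set z | P i z]| <= K) -> #|B| <= m * K.
Proof.
move=> leAm cover leK.
have sub : B \subset \bigcup_(i in A) [set z | P i z].
  by apply/subsetP => z /cover[i iA Piz]; apply/bigcupP; exists i => //; rewrite inE.
apply: leq_trans (subset_leq_card sub) _.
have unionle : #|\bigcup_(i in A) [set z | P i z]| <= \sum_(i in A) #|[set z | P i z]|.
  elim/big_ind2: _ => [|X a Y b leX leY|//]; first by rewrite cards0.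
  exact: leq_trans (card_setU_le _ _) (leq_add leX leY).
apply: leq_trans unionle _; apply: (@leq_trans (\sum_(i in A) K)); first exact: leq_sum.
by rewrite sum_nat_const leq_mul2r leAm orbT.
Qed.

(** Each left-hand side bounds the number of points ruled out in one of the three choices of an
    auxiliary point in [color_embedding]. *)
Lemma size_bounds k n (K := (k - 1) * (k - 1) * k) : 1 < k -> 4 * (k - 1) * k ^ 3 <= n ->
  [/\ (k - 1) * (k - 1) + (k - 1) * k < n,
      (K + K) + (K + K) + ((k - 1) * k + 1) < n
    & (K + K) + (K + K) + (k - 1) * k * k < n].
Proof.
rewrite {}/K; case: k => [|m] // m_gt0; rewrite subn1 /= ltnS in m_gt0 * => le.
(* Since [k >= 2], the hypothesis gives [n >= 8 * (k - 1) * k ^ 2], which is cubic like the sums to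
   be bounded. *)
have le2 : 2 * (m * m.+1 * m.+1) <= m * m.+1 ^ 3.
  have -> : m * m.+1 ^ 3 = m.+1 * (m * m.+1 * m.+1) by rewrite !expnS expn0; lia.
  by rewrite leq_mul2r ltnS m_gt0 orbT.
by split; nia.
Qed.

(** * Fixed-point counts in a Frobenius group *)

Section FrobeniusCounting.
Variables (Omega : finType) (G : {group {perm Omega}}) (k : nat).

Definition orbital (x y : Omega) : {set Omega * Omega} :=
  [set ((g : {perm Omega}) x, (g : {perm Omega}) y) | g in G].

Definition stab (x : Omega) : {set {perm Omega}} := [set g in G | g x == x].

Lemma stabP g x : reflect (g \in G /\ g x = x) (g \in stab x).
Proof. by rewrite inE; apply: (iffP andP) => -[? /eqP]. Qed.

Lemma mem_orbital x y : (x, y) \in orbital x y.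
Proof. by apply/imsetP; exists 1%g; rewrite ?group1 // !perm1. Qed.

Lemma orbital_act g x y : g \in G -> orbital (g x) (g y) = orbital x y.
Proof.
move=> gG; apply/setP => p; apply/imsetP/imsetP => -[h hG ->].
  by exists (g * h)%g; rewrite ?groupM // !permM.
exists (g^-1 * h)%g; first by rewrite groupM ?groupV.
by rewrite !permM !permK.
Qed.

Lemma orbitalP x y u v :
  reflect (exists2 g : {perm Omega}, g \in G & g x = u /\ g y = v)
          (orbital x y == orbital u v).
Proof.
apply: (iffP eqP) => [e|[g gG [<- <-]]]; last by rewrite orbital_act.
by have := mem_orbital u v; rewrite -e => /imsetP[g gG [-> ->]]; exists g.
Qed.

Lemma orbital_left_eq x y z :
  orbital x y = orbital x z -> exists2 g : {perm Omega}, g \in stab x & g y = z.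
Proof. by move/eqP/orbitalP => [g gG [gx gy]]; exists g => //; apply/stabP. Qed.

Hypothesis semiregular : forall g, g \in G -> forall a b : Omega, a != b ->
  g a = a -> g b = b -> g = 1%g.
Hypothesis card_stab : forall x, #|stab x| <= k.

Lemma card_stab1 x : #|stab x :\ 1%g| <= k - 1.
Proof.
have := card_stab x; rewrite (cardsD1 1%g) (_ : 1%g \in stab x).
  by move/(leq_sub2r 1); rewrite addKn.
by apply/stabP; rewrite group1 perm1.
Qed.

(** A point where [g] and [h] agree is fixed by [g * h^-1], which is not the identity. *)
Lemma card_fix_le1 g h : g \in G -> h \in G -> g != h ->
  #|[set z : Omega | g z == h z]| <= 1.
Proof.
move=> gG hG ne; apply/card_le1P => x /[!inE] /eqP gx y /[!inE].
apply/eqP/eqP => [gy|->//]; apply/eqP; apply: contraNT ne => ne.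
have e : (g * h^-1 = 1)%g.
  apply: (semiregular _ ne); rewrite ?groupM ?groupV // permM ?gx ?gy permK //.
by rewrite -(mulgKV h g) e mul1g.
Qed.

(** Such a [z] is fixed by some [g] in [G] taking [x] to [y]. These [g] lie in one coset of the
    stabilizer of [x], none is the identity, and each fixes at most one point. *)
Lemma card_equidistant_le x y : x != y ->
  #|[set z | orbital z x == orbital z y]| <= k.
Proof.
move=> ne; rewrite -[k]muln1.
apply: (@card_cover_le _ _ [set g in G | g x == y] _
  (fun (g : {perm Omega}) z => g z == z)).
- case: (set_0Vmem [set g in G | g x == y]) => [->|[g0]]; first by rewrite cards0.
  rewrite inE => /andP[g0G /eqP g0x].
  apply: leq_trans (card_stab x).
  rewrite -(card_imset _ (mulIg g0^-1)%g); apply: subset_leq_card.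
  apply/subsetP => _ /imsetP[g /[!inE] /andP[gG /eqP gx] ->].
  by rewrite groupM ?groupV // permM gx -g0x permK eqxx.
- move=> z /[!inE] /eqP /orbital_left_eq[g /stabP[gG gz] gx].
  by exists g; rewrite ?inE ?gG ?gx ?gz /=.
- move=> g /[!inE] /andP[gG /eqP gx].
  have := @card_fix_le1 g 1%g gG (group1 G); under eq_finset do rewrite perm1.
  apply; apply: contra_neq ne => g1.
  by rewrite -gx g1 perm1.
Qed.

(* For c different from a and b: c is the only point with its colours to a and b. *)
Definition separated (a b c : Omega) : bool :=
  [forall g in stab a :\ 1%g, forall h in stab b :\ 1%g,
    (g : {perm Omega}) c != (h : {perm Omega}) c].

(* Apart from the colour of (c, d), no colour of a pair starting at c is
   compatible with the colours of both (a, d) and (b, d). *)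
Definition determined (a b c d : Omega) : bool :=
  [forall g in stab a :\ 1%g, forall h in stab b :\ 1%g,
    orbital c ((g : {perm Omega}) d) != orbital c ((h : {perm Omega}) d)].

Lemma separatedPn a b c :
  reflect (exists g h, [/\ g \in stab a :\ 1%g, h \in stab b :\ 1%g & g c = h c])
          (~~ separated a b c).
Proof.
rewrite negb_forall_in; apply: (iffP exists_inP) => [[g gs]|[g [h [gs hs e]]]].
  by rewrite negb_forall_in => /exists_inP[h hs /negPn/eqP e]; exists g, h.
by exists g => //; rewrite negb_forall_in; apply/exists_inP; exists h; rewrite ?e ?negbK.
Qed.

Lemma determinedPn a b c d :
  reflect (exists g h, [/\ g \in stab a :\ 1%g, h \in stab b :\ 1%g
                         & orbital c (g d) = orbital c (h d)])
          (~~ determined a b c d).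
Proof.
rewrite negb_forall_in; apply: (iffP exists_inP) => [[g gs]|[g [h [gs hs e]]]].
  by rewrite negb_forall_in => /exists_inP[h hs /negPn/eqP e]; exists g, h.
by exists g => //; rewrite negb_forall_in; apply/exists_inP; exists h; rewrite ?e ?negbK.
Qed.

Lemma stab1_neq g a c : g \in stab a :\ 1%g -> c != a -> g c != c.
Proof.
rewrite in_setD1 => /andP[g1 /stabP[gG ga]] ne; apply: contra_neq g1 => gc.
exact: (semiregular gG ne).
Qed.

Lemma stab1_disjoint g a b : a != b -> g \in stab a :\ 1%g -> g \notin stab b :\ 1%g.
Proof.
move=> ne gs; have := stab1_neq gs; rewrite eq_sym in ne => /(_ _ ne) gb.
by rewrite !inE (negPf gb) !andbF.
Qed.

Lemma stab1G g a : g \in stab a :\ 1%g -> g \in G.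
Proof. by rewrite !inE => /andP[_ /andP[]]. Qed.

Lemma card_stab1X a b : #|setX (stab a :\ 1%g) (stab b :\ 1%g)| <= (k - 1) * (k - 1).
Proof. by rewrite cardsX leq_mul ?card_stab1. Qed.

(** The stabilizers of [a] and [b] meet trivially, so nontrivial elements of them are distinct and
    agree at one point at most. *)
Lemma card_not_separated a b : a != b ->
  #|[set c | ~~ separated a b c]| <= (k - 1) * (k - 1).
Proof.
move=> ne; rewrite -[leqRHS]muln1.
apply: (card_cover_le (P := fun p c => (p.1 : {perm Omega}) c == (p.2 : {perm Omega}) c)
  (card_stab1X a b)).
  move=> c /[!inE] /separatedPn[g [h [gs hs e]]].
  by exists (g, h); rewrite ?in_setX /= ?gs ?hs ?e.
case=> g h /[!in_setX] /= /andP[gs hs].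
apply: card_fix_le1; rewrite ?(stab1G gs) ?(stab1G hs) //.
by apply: contraNneq (stab1_disjoint ne gs) => ->.
Qed.

(** If [h] fixes [b] and [g c = h c], then [b] sees the distinct points [c] and [g c] in the same
    colour. *)
Lemma card_not_separated_mid a c : c != a ->
  #|[set b | ~~ separated a b c]| <= (k - 1) * k.
Proof.
move=> ne.
apply: (card_cover_le (P := fun (g : {perm Omega}) b => orbital b c == orbital b (g c))
  (card_stab1 a)).
  move=> b /[!inE] /separatedPn[g [h [gs hs e]]]; exists g => //.
  apply/orbitalP; exists h; first exact: stab1G hs.
  by move: hs; rewrite !inE e => /andP[_ /andP[_ /eqP]].
by move=> g gs; apply: card_equidistant_le; rewrite eq_sym (stab1_neq gs).
Qed.

(** Equal colours give [f] fixing [c] with [f (g d) = h d], so [g * f] and [h] agree at [d]. If they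
    were equal, [g^-1] and [h^-1] would agree at [c], against separation. *)
Lemma card_not_determined a b c : separated a b c ->
  #|[set d | ~~ determined a b c d]| <= (k - 1) * (k - 1) * k.
Proof.
move=> sep; rewrite -[leqRHS]muln1.
apply: (@card_cover_le _ _ (setX (setX (stab a :\ 1%g) (stab b :\ 1%g)) (stab c)) _
  (fun p d => (p.1.1 * p.2 : {perm Omega})%g d == (p.1.2 : {perm Omega}) d)).
- by rewrite cardsX leq_mul ?card_stab1X.
- move=> d /[!inE] /determinedPn[g [h [gs hs /orbital_left_eq[f fs fg]]]].
  by exists ((g, h), f); rewrite ?in_setX /= ?gs ?hs ?fs // permM fg.
case=> -[g h] f /[!in_setX] /= /andP[/andP[gs hs] /stabP[fG fc]].
apply: card_fix_le1; rewrite ?groupM ?(stab1G gs) ?(stab1G hs) //.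
apply: contraL sep => /eqP e; apply/separatedPn.
exists g^-1%g, h^-1%g; split.
- by move: gs; rewrite !inE groupV invg_eq1 => /and3P[-> -> /eqP {1}<-]; rewrite permK eqxx.
- by move: hs; rewrite !inE groupV invg_eq1 => /and3P[-> -> /eqP {1}<-]; rewrite permK eqxx.
by rewrite -e invMg permM -{2}fc permK.
Qed.

(** Separation makes [g d] and [h d] distinct, so each pair [g], [h] costs at most [k] points
    [c]. *)
Lemma card_not_determined_mid a b d : separated a b d ->
  #|[set c | ~~ determined a b c d]| <= (k - 1) * (k - 1) * k.
Proof.
move=> sep.
apply: (card_cover_le (P := fun p c => orbital c ((p.1 : {perm Omega}) d)
  == orbital c ((p.2 : {perm Omega}) d)) (card_stab1X a b)).
  move=> c /[!inE] /determinedPn[g [h [gs hs e]]].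
  by exists (g, h); rewrite ?in_setX /= ?gs ?hs ?e.
case=> g h /[!in_setX] /= /andP[gs hs]; apply: card_equidistant_le.
by apply: contraL sep => /eqP e; apply/separatedPn; exists g, h.
Qed.

(** If [f] fixes [c] and [f (g d) = h d], then [b], being fixed by [h], sees [d] and [f (g d)] in
    the same colour. These differ, as otherwise [f^-1] and [g] would agree at [d]. Counting pairs
    [(g, f)] avoids the stabilizer of the varying [b]. *)
Lemma card_not_determined_base a c d : separated c a d -> d != a ->
  #|[set b | ~~ determined a b c d]| <= (k - 1) * k * k.
Proof.
move=> sep ne.
apply: (@card_cover_le _ _ (setX (stab a :\ 1%g) (stab c)) _
  (fun p b => orbital b d == orbital b ((p.1 * p.2 : {perm Omega})%g d))).
- by rewrite cardsX leq_mul ?card_stab1.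
- move=> b /[!inE] /determinedPn[g [h [gs hs /orbital_left_eq[f fs fg]]]].
  exists (g, f); rewrite ?in_setX /= ?gs ?fs // permM fg.
  apply/orbitalP; exists h; first exact: stab1G hs.
  by move: hs; rewrite !inE => /andP[_ /andP[_ /eqP]].
case=> g f /[!in_setX] /= /andP[gs /stabP[fG fc]]; apply: card_equidistant_le.
apply: contraL sep => /eqP e; apply/separatedPn; exists f^-1%g, g; split => //.
  rewrite !inE groupV invg_eq1 fG -{1}fc permK eqxx !andbT.
  apply: contra_neq (stab1_neq gs ne) => f1.
  by rewrite {2}e f1 mulg1.
by rewrite {1}e permM permK.
Qed.

(** * Triangles and paths of colours in the second scheme *)

(* [color x' y'] stands for the phi-preimage of the class of S' containing (x', y'). *)
Section Recolouring.
Variables (Omega' : finType) (color : Omega' -> Omega' -> {set Omega * Omega}).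
Hypothesis color_im : forall x' y', exists x y, color x' y' = orbital x y.
Hypothesis color_surj : forall x y, exists x' y', color x' y' = orbital x y.
Hypothesis color_triangle : forall x' y' x y, color x' y' = orbital x y -> forall p q,
  #|[set z' | (color x' z' == p) && (color z' y' == q)]|
  = #|[set z | (orbital x z == p) && (orbital z y == q)]|.
Hypothesis color_diag : forall x' x, color x' x' = orbital x x.

Lemma color_extend x' y' x y z : color x' y' = orbital x y ->
  exists z', color x' z' = orbital x z /\ color z' y' = orbital z y.
Proof.
move=> /color_triangle /(_ (orbital x z) (orbital z y)) e.
have : 0 < #|[set t | (orbital x t == orbital x z) && (orbital t y == orbital z y)]|.
  by apply/card_gt0P; exists z; rewrite inE !eqxx.
by rewrite -e => /card_gt0P[z' /[!inE] /andP[/eqP ? /eqP ?]]; exists z'.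
Qed.

Lemma color_retract x' y' x y z' : color x' y' = orbital x y ->
  exists z, orbital x z = color x' z' /\ orbital z y = color z' y'.
Proof.
move=> /color_triangle /(_ (color x' z') (color z' y')) e.
have : 0 < #|[set t | (color x' t == color x' z') && (color t y' == color z' y')]|.
  by apply/card_gt0P; exists z'; rewrite inE !eqxx.
by rewrite e => /card_gt0P[z /[!inE] /andP[/eqP ? /eqP ?]]; exists z.
Qed.

(** Retract the degenerate triangle on [x'], [y'], [x']: its middle point is moved to [y] by an
    element fixing [x]. *)
Lemma color_sym x' y' x y : color x' y' = orbital x y -> color y' x' = orbital y x.
Proof.
move=> e; have [z [xz <-]] := color_retract y' (color_diag x' x).
move: xz; rewrite e => /orbital_left_eq[g /stabP[gG gx] <-].
by rewrite -{2}gx orbital_act.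
Qed.

(** Retract the triangle to [Omega] and move its first two points to [c] and [a]. The third then has
    the colour of [d] from [a], so it is an image of [d] under the stabilizer of [a]. *)
Lemma color_path c' a' d' c a d :
  color c' a' = orbital c a -> color a' d' = orbital a d ->
  exists2 g : {perm Omega}, g \in stab a & color c' d' = orbital c (g d).
Proof.
move=> eca ead; have [u [v euv]] := color_im c' d'.
have [z []] := color_retract a' euv.
rewrite eca ead => /eqP/orbitalP[g gG [gu gz]].
rewrite -(orbital_act z v gG) gz => /esym/orbital_left_eq[h hs hd].
by exists h; rewrite // hd euv -gu orbital_act.
Qed.

(** The paths through [a] and [b] express one colour as [orbital c (g d)] and [orbital c (h d)], so
    [g] and [h] cannot both be nontrivial. *)
Lemma color_determined a' b' c' d' a b c d : determined a b c d ->
  color c' a' = orbital c a -> color a' d' = orbital a d ->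
  color c' b' = orbital c b -> color b' d' = orbital b d ->
  color c' d' = orbital c d.
Proof.
move=> det eca ead ecb ebd.
have [g gs eg] := color_path eca ead; have [h hs eh] := color_path ecb ebd.
have [g1|g1] := eqVneq g 1%g; first by rewrite eg g1 perm1.
have [h1|h1] := eqVneq h 1%g; first by rewrite eh h1 perm1.
case/determinedPn: det; exists g, h; split; last by rewrite -eg.
  by rewrite in_setD1 g1.
by rewrite in_setD1 h1.
Qed.

(** * Construction of the isomorphism *)

Hypothesis k_gt1 : 1 < k.
Hypothesis large : 4 * (k - 1) * k ^ 3 <= #|Omega|.

Lemma color_map_from_base (a0 b0 : Omega) : a0 != b0 ->
  exists a0' (F : Omega -> Omega'),
    (forall z, color a0' (F z) = orbital a0 z) /\
    (forall c, separated a0 b0 c ->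
      #|[set d : Omega | color (F c) (F d) != orbital c d]| <= (k - 1) * (k - 1) * k).
Proof.
move=> ne; have [a0' [b0' e0]] := color_surj a0 b0.
have /fin_all_exists[F FP] : forall z, exists z',
    color a0' z' = orbital a0 z /\ color z' b0' = orbital z b0.
  by move=> z; apply: color_extend.
exists a0', F; split=> [z|c sep]; first by case: (FP z).
apply: leq_trans (card_not_determined sep); apply: subset_leq_card.
apply/subsetP => d; rewrite !inE; apply: contra => det; apply/eqP.
have [ac cb] := FP c; have [ad db] := FP d.
exact: color_determined det (color_sym ac) ad cb (color_sym db).
Qed.

Lemma color_embedding (a0 b0 : Omega) : a0 != b0 ->
  exists f : Omega -> Omega', forall x y, color (f x) (f y) = orbital x y.
Proof.
move=> ne; have [a0' [F [Fa0 FP]]] := color_map_from_base ne.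
have := size_bounds k_gt1 large.
set K := (k - 1) * (k - 1) * k; case=> bound0 bound1 bound2.
have /fin_all_exists[f fP] : forall c : Omega, exists c' : Omega',
    #|[set d : Omega | color c' (F d) != orbital c d]| <= K + K.
  move=> c; have [->|ca] := eqVneq c a0.
    exists a0'; rewrite (_ : [set d | _] = set0) ?cards0 //.
    by apply/setP => d; rewrite !inE Fa0 eqxx.
  (* The pair [a0], [e] serves as a base adapted to [c]: the image of [d] can fail only if [F e] has
     the wrong colour to [F d], or if [d] and [c] are not determined by this base. *)
  have [e] : exists e, e \notin [set e | ~~ separated a0 b0 e] :|: [set e | ~~ separated a0 e c].
    apply: exists_notin; apply: leq_ltn_trans (card_setU_le _ _) _.
    have := card_not_separated ne; have := card_not_separated_mid ca.
    lia.
  rewrite !inE negb_or !negbK => /andP[sep0 sepc].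
  have [c' [ac ce]] := color_extend c (Fa0 e).
  exists c'; apply: leq_trans (leq_add (FP e sep0) (card_not_determined_mid sepc)).
  apply: leq_trans (card_setU_le _ _); apply: subset_leq_card.
  apply/subsetP => d; rewrite !inE; apply: contraR.
  rewrite negb_or !negbK => /andP[/eqP ed det]; apply/eqP/color_sym.
  exact: color_determined det (color_sym (Fa0 d)) ac (color_sym ed) (color_sym ce).
exists f => c d; have [->|ncd] := eqVneq c d; first exact: color_diag.
pose N x := [set e : Omega | color (f x) (F e) != orbital x e].
(* Besides having the right colours to [f c] and [f d], [e1] is chosen so that few points [e2] fail
   to determine [(c, d)] together with it. *)
have [e1] : exists e, e \notin (N c :|: N d) :|: ([set e | ~~ separated c e d] :|: [set d]).
  apply: exists_notin; apply: leq_ltn_trans (card_setU_le _ _) _.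
  have := card_setU_le (N c) (N d); have := fP c; have := fP d.
  have := card_setU_le [set e | ~~ separated c e d] [set d].
  have dc : d != c by rewrite eq_sym.
  have := card_not_separated_mid dc; rewrite cards1 /N.
  lia.
rewrite !inE !negb_or !negbK => /andP[/andP[/eqP ce1 /eqP de1] /andP[sep ne1]].
rewrite eq_sym in ne1.
have [e2] : exists e, e \notin (N c :|: N d) :|: [set e | ~~ determined e1 e c d].
  apply: exists_notin; apply: leq_ltn_trans (card_setU_le _ _) _.
  have := card_setU_le (N c) (N d); have := fP c; have := fP d.
  have := card_not_determined_base sep ne1; rewrite /N.
  lia.
rewrite !inE !negb_or !negbK => /andP[/andP[/eqP ce2 /eqP de2] det].
exact: color_determined det ce1 (color_sym de1) ce2 (color_sym de2).
Qed.

(** Sort the points by their colours from and to a fixed point; the class sizes agree by the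
    triangle counts on the diagonal. *)
Lemma card_recolouring (x' : Omega') (x : Omega) : #|Omega'| = #|Omega|.
Proof.
have count (O : finType) (u v : O -> {set Omega * Omega}) :
    #|O| = \sum_p \sum_q #|[set z | (u z == p) && (v z == q)]|.
  rewrite -sum1_card (partition_big u xpredT) //=; apply: eq_bigr => p _.
  rewrite (partition_big v xpredT) //=; apply: eq_bigr => q _.
  by rewrite -sum1dep_card; apply: eq_bigl.
rewrite (count _ (color x') (color^~ x')) (count _ (orbital x) (orbital^~ x)).
apply: eq_bigr => p _; apply: eq_bigr => q _.
exact/color_triangle/color_diag.
Qed.

Lemma color_isomorphism (a0 b0 : Omega) : a0 != b0 ->
  exists f : Omega -> Omega', bijective f /\ forall x y, color (f x) (f y) = orbital x y.
Proof.
move=> ne; have [f fP] := color_embedding ne; exists f; split=> //.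
apply: inj_card_bij; last by rewrite (card_recolouring (f a0) a0).
move=> x y e; have := fP x y; rewrite -e (color_diag _ x).
by case/orbital_left_eq => g /stabP[_ gx] <-.
Qed.

End Recolouring.
End FrobeniusCounting.

(** * Intersection numbers, rank and valency of the orbitals *)

Section Orbitals.
Variables (Omega : finType) (G : {group {perm Omega}}).

Lemma orbital_in x y : orbital G x y \in orbitals G.
Proof. by apply/imsetP; exists (x, y). Qed.

Lemma orbitalsP s : s \in orbitals G -> exists x y, s = orbital G x y.
Proof. by case/imsetP => -[x y] _ ->; exists x, y. Qed.

Lemma mem_orbital_eq s x y : s \in orbitals G -> ((x, y) \in s) = (orbital G x y == s).
Proof.
case/orbitalsP => u [v ->]; apply/imsetP/orbitalP => [[g gG [-> ->]]|[g gG [gx gy]]].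
  by exists g^-1%g; rewrite ?groupV // !permK.
by exists g^-1%g; rewrite ?groupV // -gx -gy !permK.
Qed.

Lemma nbetaE r s x y : r \in orbitals G -> s \in orbitals G ->
  nbeta r s x y = #|[set z | (orbital G x z == r) && (orbital G z y == s)]|.
Proof. by move=> rS sS; apply: eq_card => z; rewrite !inE !mem_orbital_eq. Qed.

(** [inum] evaluates at an arbitrarily picked pair; the group element carrying [(x, y)] to that pair
    permutes the middle points. *)
Lemma inum_orbital r s x y : r \in orbitals G -> s \in orbitals G ->
  inum r s (orbital G x y) = nbeta r s x y.
Proof.
move=> rS sS; rewrite /inum; case: pickP => [p|/(_ (x, y))]; last by rewrite mem_orbital.
case/imsetP => g gG -> /=; rewrite !nbetaE // -[RHS](card_imset _ (@perm_inj _ g)).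
apply: eq_card => z; rewrite -(permKV g z) (mem_imset _ _ (@perm_inj _ g)) !inE.
by rewrite !orbital_act.
Qed.

Hypothesis frobG : frobenius G.

Lemma frobenius_semiregular g : g \in G -> forall a b : Omega, a != b ->
  g a = a -> g b = b -> g = 1%g.
Proof. by case: frobG => _ _; apply. Qed.

Lemma orbital_diag x : orbital G x x = diag Omega.
Proof.
case: frobG => tr _ _; apply/setP => -[u v]; rewrite inE /=; apply/imsetP/eqP => [[g _ [-> ->]//]|<-].
have [g gG ->] := atransP2 tr (in_setT x) (in_setT u).
by exists g.
Qed.

Lemma frobenius_nontrivial : exists a, exists2 g : {perm Omega}, g \in stab G a & exists b, g b != b.
Proof.
case: frobG => _ [a ne1] _; exists a.
have /trivgPn[g] := ne1; rewrite inE => /andP[gG /astab1P ga] g1.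
exists g; first by apply/stabP.
apply/existsP; apply: contraR g1; rewrite negb_exists => /forallP e.
by apply/eqP/permP => b; rewrite perm1; apply/eqP; rewrite -[_ == _]negbK.
Qed.

(** By transitivity every orbital contains a pair starting at [a]. This turns the rank bound into a
    bound on the number of points. *)
Lemma card_orbitals_le : #|orbitals G| <= #|Omega|.
Proof.
have [a _] := frobenius_nontrivial; case: frobG => tr _ _.
apply: leq_trans (leq_imset_card (orbital G a) Omega); apply: subset_leq_card.
apply/subsetP => s /orbitalsP[x [y ->]].
have [g gG xa] := atransP2 tr (in_setT x) (in_setT a).
by apply/imsetP; exists (g y) => //; rewrite xa orbital_act.
Qed.

(** For [y] distinct from [x], [h] is determined in the stabilizer of [x] by [h y], which is a
    neighbour of [x] in the orbital of [(x, y)]. *)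
Lemma card_stab_valency k :
  (forall s, s \in orbitals G -> s != diag Omega -> has_valency s k) ->
  forall x, #|stab G x| <= k.
Proof.
move=> val x; have [a [g _ [b gb]]] := frobenius_nontrivial.
have [y nxy] : exists y, x != y.
  by have [->|] := eqVneq x b; [exists (g b); rewrite eq_sym | exists b].
have nd : orbital G x y != diag Omega.
  by apply: contraNneq nxy => e; have := mem_orbital G x y; rewrite e inE.
rewrite -(val _ (orbital_in x y) nd x) /valency_at.
rewrite -(card_in_imset (f := fun h : {perm Omega} => h y)).
  apply: subset_leq_card; apply/subsetP => _ /imsetP[h /stabP[hG hx] ->].
  by rewrite inE; apply/imsetP; exists h; rewrite // hx.
move=> h1 h2 /stabP[h1G h1x] /stabP[h2G h2x] e; rewrite -(mulgKV h2 h1).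
suff -> : (h1 * h2^-1)%g = 1%g by rewrite mul1g.
apply: (frobenius_semiregular _ nxy); rewrite ?groupM ?groupV // permM.
  by rewrite h1x -{1}h2x permK.
by rewrite e permK.
Qed.

End Orbitals.

(** * Transfer along the algebraic isomorphism *)

Theorem theorem1p2 (Omega : finType) (G : {group {perm Omega}}) (k : nat) :
  frobenius G ->
  (forall s, s \in orbitals G -> s != diag Omega -> has_valency s k) ->
  4 * (k - 1) * k ^ 3 <= #|orbitals G| ->
  forall (Omega' : finType) (S' : {set {set Omega' * Omega'}}),
    scheme S' ->
    forall phi : {set Omega * Omega} -> {set Omega' * Omega'},
      alg_iso (orbitals G) S' phi ->
      exists f : Omega -> Omega', induces (orbitals G) f phi.
Proof.
move=> frobG val rank Omega' S' [[partS' _ _ cohS'] diagS'] phi [phi_inj phiS phi_inum].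
have semireg := frobenius_semiregular frobG.
have cardst := card_stab_valency frobG val.
have large := leq_trans rank (card_orbitals_le frobG).
have [a [g gs [b gb]]] := frobenius_nontrivial frobG.
have k_gt1 : 1 < k.
  apply: leq_trans (cardst a); rewrite (cardD1 1%g) (cardD1 g) !inE group1 perm1 eqxx.
  have /stabP[-> ->] := gs; rewrite eqxx !andbT.
  suff -> : g != 1%g by [].
  by apply: contraNneq gb => ->; rewrite perm1.
have [S'cover S'triv S'n0] := and3P partS'.
have phi_mem s : s \in orbitals G -> phi s \in S' by move=> sS; rewrite -phiS imset_f.
have phi_unique x' y' s t : s \in orbitals G -> t \in orbitals G ->
    (x', y') \in phi s -> (x', y') \in phi t -> s = t.
  move=> sS tS sx tx; apply: phi_inj => //.
  by rewrite -(def_pblock S'triv (phi_mem _ sS) sx) (def_pblock S'triv (phi_mem _ tS) tx).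
have phi_cover x' y' : exists2 s, s \in orbitals G & (x', y') \in phi s.
  have : (x', y') \in cover S' by rewrite (eqP S'cover) inE.
  case/bigcupP => s'; rewrite -phiS => /imsetP[s sS ->]; by exists s.
(* The default [set0] never occurs, since the images under [phi] cover all pairs. *)
pose color x' y' := odflt set0 [pick s in orbitals G | (x', y') \in phi s].
have colorP x' y' : color x' y' \in orbitals G /\ (x', y') \in phi (color x' y').
  rewrite /color; case: pickP => [s /andP[]//|no].
  by have [s sS sx] := phi_cover x' y'; have := no s; rewrite /= sS sx.
have colorE x' y' s : s \in orbitals G -> ((x', y') \in phi s) = (color x' y' == s).
  move=> sS; have [cS cx] := colorP x' y'; apply/idP/eqP => [sx|<-//].
  exact: phi_unique cx sx.
have color_im x' y' : exists x y, color x' y' = orbital G x y.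
  by have [/orbitalsP] := colorP x' y'.
have color_surj x y : exists x' y', color x' y' = orbital G x y.
  have xyS := orbital_in G x y.
  have /set0Pn[[x' y']] : phi (orbital G x y) != set0.
    by apply: contraNneq S'n0 => <-; apply: phi_mem.
  by rewrite colorE // => /eqP; exists x', y'.
have color_triangle x' y' x y : color x' y' = orbital G x y -> forall p q,
    #|[set z' | (color x' z' == p) && (color z' y' == q)]|
    = #|[set z | (orbital G x z == p) && (orbital G z y == q)]|.
  move=> e p q; have xyS := orbital_in G x y.
  (* A set that is not an orbital is the colour of no pair, so both counts vanish. *)
  have [pS|pS] := boolP (p \in orbitals G); last first.
    transitivity 0; last symmetry; apply: eq_card0 => z; rewrite inE; apply: contraNF pS => /andP[/eqP <- _].
      by case: (colorP x' z).
    exact: orbital_in.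
  have [qS|qS] := boolP (q \in orbitals G); last first.
    transitivity 0; last symmetry; apply: eq_card0 => z; rewrite inE; apply: contraNF qS => /andP[_ /eqP <-].
      by case: (colorP z y').
    exact: orbital_in.
  rewrite -nbetaE // -(inum_orbital x y pS qS) -phi_inum // /inum.
  have xy' : (x', y') \in phi (orbital G x y) by rewrite colorE ?e.
  case: pickP => [t tx|/(_ (x', y'))]; last by rewrite xy'.
  (* Coherence of [S'] replaces the pair picked by [inum] with [(x', y')]. *)
  rewrite (cohS' _ _ _ (phi_mem _ pS) (phi_mem _ qS) (phi_mem _ xyS) _ _ tx xy') /=.
  by apply: eq_card => z; rewrite !inE !colorE.
(* The relation t sent to the diagonal satisfies c_{t t0}^{t0} > 0 for the
   diagonal t0, which forces t = t0. *)
have color_diag x' x : color x' x' = orbital G x x.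
  have [x1 [y1 e1]] := color_surj x x.
  have d1 : (x', x') \in diag Omega' by rewrite inE.
  have d2 : (x1, x1) \in diag Omega' by rewrite inE.
  have : diag Omega' \in phi @: orbitals G by rewrite phiS.
  case/imsetP => t tS dt; move: d1 d2; rewrite dt !colorE // => /eqP-> /eqP e2.
  have : 0 < #|[set z' | (color x1 z' == t) && (color z' y1 == orbital G x x)]|.
    by apply/card_gt0P; exists x1; rewrite inE e1 e2 !eqxx.
  rewrite (color_triangle _ _ _ _ e1) => /card_gt0P[z]; rewrite inE => /andP[/eqP <-].
  by case/orbitalP => h _ [<- /perm_inj ->].
have nab : a != b by apply: contraNneq gb => <-; case/stabP: gs => _ ->.
have [f [f_bij fP]] := color_isomorphism semireg cardst color_im color_surj
  color_triangle color_diag k_gt1 large nab.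
have [h fK hK] := f_bij.
exists f; split=> // s sS; apply/setP => -[x' y']; rewrite colorE // -(hK x') -(hK y') fP.
rewrite -mem_orbital_eq //; apply/imsetP/idP => [[[x y] xys [/(can_inj fK)-> /(can_inj fK)->]//]|xys].
by exists (h x', h y').
Qed.
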